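(* For every $n\ge0$, the number of $d$-avoiding GNC-trees with $n+1$ vertices is $$|\mathsf{GNC}_n(d)|=\sum_{i+j=n}\frac{i}{3j+i}\binom{3j+i}{j}2^iC_i,$$ where $C_i=\frac{1}{i+1}\binom{2i}{i}$ and the sum is over nonnegative integers $i,j$.
   Context: A non-crossing tree on $n+1$ points: place $n+1$ points $p_0,\dots,p_n$ on a circle in counterclockwise order and draw a tree on them with straight edges inside the circle, no two crossing. A (rooted) GNC-tree with $n+1$ vertices is such a tree with a labelling of the points by positive integers, weakly increasing along $p_0,\dots,p_n$, $p_0$ labelled 1, label set $\{1,\dots,m\}$ for some $m$; rooted at $p_0$. $\mathsf{GNC}_n$ is the set of these. Orient each edge from parent (closer to root) to child; it is an ascent ($u$) if parent label $<$ child label, a level ($h$) if equal, a descent ($d$) if larger. $\mathsf{GNC}_n(d)$ is the set of trees in $\mathsf{GNC}_n$ with no descent edge. The factor $\frac{i}{3j+i}\binom{3j+i}{j}$ denotes $[t^j]\,F(t)^i$ where $F(t)=\sum_{k\ge0}\frac{1}{2k+1}\binom{3k}{k}t^k$; in particular for $i=0$ it equals $1$ if $j=0$ and $0$ otherwise. *)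

(* Defs.v *)
From mathcomp Require Import all_boot all_order all_algebra.

Set Implicit Arguments.
Unset Strict Implicit.
Unset Printing Implicit Defensive.

Import GRing.Theory Num.Theory.

Section Graphs.

Variable V : finType.
Implicit Types (E : {set {set V}}) (u v : V).

(* A simple graph on V is given by its set of edges, an edge being a
   two-element set of vertices. *)
Definition simple_graph E : bool := [forall e in E, #|e| == 2].

Definition adj E : rel V := fun u v => [set u; v] \in E.

Definition connected_graph E : bool :=
  [forall u, forall v, connect (adj E) u v].

(* No cycle: a cycle is a cyclic sequence of at least 3 pairwise distinct
   vertices, so that its length k cannot exceed #|V|. *)
Definition acyclic_graph E : bool :=
  [forall k : 'I_#|V|.+1, (2 < k) ==>
    [forall c : k.-tuple V, ~~ ucycleb (adj E) c]].

Definition tree E : bool :=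
  [&& simple_graph E, connected_graph E & acyclic_graph E].

Definition walk_of_length E (k : nat) u v : bool :=
  [exists p : k.-tuple V, path (adj E) u p && (last u p == v)].

(* The graph distance: the length of a shortest walk (by convention #|V| when
   there is no walk, which does not happen in a connected graph). *)
Definition dist E u v : nat :=
  find (fun k => walk_of_length E k u v) (iota 0 #|V|).

End Graphs.

Section GNC.

Variable n : nat.

(* p_0, ..., p_n are the elements of 'I_n.+1, listed in counterclockwise
   order. *)
Implicit Types (E : {set {set 'I_n.+1}}) (u v : 'I_n.+1).

(* Two chords of a circle cross iff their endpoints interleave. *)
Definition noncrossing E : bool :=
  [forall a : 'I_n.+1, forall b : 'I_n.+1,
   forall c : 'I_n.+1, forall d : 'I_n.+1,
     [&& a < b, b < c & c < d] ==> ~~ (adj E a c && adj E b d)].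

(* The labels of n + 1 points form a set {1, ..., m} with m <= n + 1, hence
   they can be taken in 'I_n.+2 = {0, ..., n + 1} without loss of generality;
   the value 0 is excluded by the last condition. *)
Definition labelling (l : {ffun 'I_n.+1 -> 'I_n.+2}) : bool :=
  [&& [forall u : 'I_n.+1, forall v : 'I_n.+1, (u <= v) ==> (l u <= l v)],
      l ord0 == 1 :> nat &
      [exists m : 'I_n.+2,
         [set l v | v : 'I_n.+1] == [set k : 'I_n.+2 | 0 < k <= m]]].

Definition GNC :
    {set {set {set 'I_n.+1}} * {ffun 'I_n.+1 -> 'I_n.+2}} :=
  [set T | [&& tree T.1, noncrossing T.1 & labelling T.2]].

Definition parent E u v : bool :=
  adj E u v && (dist E ord0 u < dist E ord0 v).

Definition descent (T : {set {set 'I_n.+1}} * {ffun 'I_n.+1 -> 'I_n.+2}) u v :=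
  parent T.1 u v && (T.2 v < T.2 u).

Definition GNC_d_avoiding :
    {set {set {set 'I_n.+1}} * {ffun 'I_n.+1 -> 'I_n.+2}} :=
  [set T in GNC | [forall u, forall v, ~~ descent T u v]].

End GNC.

Local Open Scope ring_scope.

Definition catalan (i : nat) : rat := 'C((2 * i)%N, i)%:R / i.+1%:R.

(* [t^k] F(t) *)
Definition F_coef (k : nat) : rat := 'C((3 * k)%N, k)%:R / (2 * k + 1)%N%:R.

(* [t^j] F(t)^i, that is i / (3j + i) * 'C(3j + i, j): only the coefficients of
   F of degree at most j contribute, so F is replaced by its truncation. *)
Definition F_pow_coef (i j : nat) : rat :=
  ((\poly_(k < j.+1) F_coef k) ^+ i)`_j.

(* Main.v *)
Require Import Defs.
From mathcomp Require Import all_boot all_order all_algebra.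
From mathcomp Require Import zify ring lra.

(* A weakly increasing labelling amounts to the choice of the gaps (p_k, p_{k+1})
   at which the label increases. It creates a descent iff it increases at a gap
   lying under an edge whose child is to the left of its parent, so a tree E
   contributes 2^(number of gaps of E not covered by such an edge).

   In a non-crossing tree on the segment [r, b] rooted at r < b, let c be the
   largest neighbour of r. Deleting the edge rc splits [r, b] into [r, m],
   [m+1, c] and [c, b], each carrying an arbitrary non-crossing tree; the gap m
   is free, those of [m+1, c] are all covered, and those of [r, m] and [c, b] are
   covered as in the trees on these segments rooted at r and c. With F and G the
   generating functions of the trees, unweighted and weighted, this reads
   F = 1 + t F^3 and G = 1 + 2 t F G^2, so G is the Catalan series at 2 t F.

   The numbers i / (pj + i) * 'C(pj + i, j) satisfy the recurrence in (i, j) that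
   B^(i+1) = B^i + t B^(i+p) imposes on [t^j] B^i. This makes them a convolution
   semigroup in i, which yields the equations of F (p = 3) and of the Catalan
   series (p = 2). *)

Set Implicit Arguments.
Unset Strict Implicit.
Unset Printing Implicit Defensive.

(** * Trees and cut vertices *)

Section TreeOn.

Variable V : finType.
Implicit Types (E : {set {set V}}) (S : {set V}) (u v x y c : V).

Lemma adjC E u v : adj E u v = adj E v u.
Proof. by rewrite /adj setUC. Qed.

Lemma adjD1 E e u v : adj (E :\ e) u v = ([set u; v] != e) && adj E u v.
Proof. by rewrite /adj !inE. Qed.

Lemma adjU E E' u v : adj (E :|: E') u v = adj E u v || adj E' u v.
Proof. by rewrite /adj inE. Qed.

Lemma adj_set1 e u v : adj [set e] u v = ([set u; v] == e).
Proof. by rewrite /adj inE. Qed.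

Lemma connect_adjC E u v : connect (adj E) u v = connect (adj E) v u.
Proof. exact/sym_connect_sym/adjC. Qed.

Lemma connect_map E E' (f : V -> V) x y :
    (forall u v, adj E u v -> connect (adj E') (f u) (f v)) ->
  connect (adj E) x y -> connect (adj E') (f x) (f y).
Proof.
move=> Hf /connectP[p]; elim: p x => [|z p IHp] x /=; first by move=> _ ->.
by case/andP=> xz pz ey; apply: connect_trans (Hf _ _ xz) (IHp _ pz ey).
Qed.

Lemma connect_adjS E E' x y :
  E \subset E' -> connect (adj E) x y -> connect (adj E') x y.
Proof.
move=> sE; apply: (@connect_map _ _ id) => u v uv.
by apply: connect1; apply: (subsetP sE).
Qed.

Definition bridge E u v : bool := ~~ connect (adj (E :\ [set u; v])) u v.

(** Acyclicity in this form survives both gluing at a cut vertex and passing to a subgraph, and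
    deleting an edge then tells which of its ends is on the side of the root. *)
Definition tree_on S E : bool :=
  [&& [forall e in E, (#|e| == 2) && (e \subset S)],
      [forall x in S, forall y in S, connect (adj E) x y] &
      [forall u, forall v, adj E u v ==> bridge E u v]].

Lemma tree_onP S E :
  reflect [/\ forall e, e \in E -> #|e| = 2 /\ e \subset S,
              forall x y, x \in S -> y \in S -> connect (adj E) x y &
              forall u v, adj E u v -> bridge E u v]
          (tree_on S E).
Proof.
apply: (iffP and3P) => [[/forall_inP He /forall_inP Hc /forallP Hb]|[He Hc Hb]].
  split=> [e /He/andP[/eqP]|x y Sx Sy|u v] //.
    by have /forall_inP/(_ y Sy) := Hc x Sx.
  by have /forallP/(_ v)/implyP := Hb u.
split.
- by apply/forall_inP => e /He[-> ->].
- by apply/forall_inP => x Sx; apply/forall_inP => y; apply: Hc.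
- by apply/forallP => u; apply/forallP => v; apply/implyP/Hb.
Qed.

(** A simple path from u to v avoiding the edge uv has at least two steps, so the edge closes it
    into a cycle. *)
Lemma acyclic_bridge E u v :
  acyclic_graph E -> u != v -> adj E u v -> bridge E u v.
Proof.
move=> acE neq_uv Euv; apply/negP => /connectP[p0 /shortenP[p pP Up _] vE].
have szp : 1 < size p.
  case: p pP vE {Up} => [|x [|? ?]] //=; first by move=> _ e; rewrite e eqxx in neq_uv.
  by rewrite andbT adjD1 => /andP[nx _] e; rewrite e eqxx in nx.
have szV : size (u :: p) < #|V|.+1 by rewrite ltnS -(card_uniqP Up) max_card.
have /forallP/(_ (Ordinal szV))/implyP/(_ szp)/forallP/(_ (in_tuple _)) := acE.
rewrite /ucycleb [in_tuple _ : seq _]/= Up andbT /= rcons_path.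
rewrite -vE adjC Euv andbT => /negP[]; apply: sub_path pP => x y.
by rewrite adjD1 => /andP[].
Qed.

(** On a cycle x, y, z, ..., going the other way round leads from y to x: the step yz is not xy, and
    the rest never visits y. *)
Lemma bridge_acyclic E :
  (forall u v, adj E u v -> bridge E u v) -> acyclic_graph E.
Proof.
move=> bE; apply/forallP => k; apply/implyP => k2; apply/forallP => c.
apply/negP => /andP[]; have := size_tuple c.
case: (val c) => [|x [|y [|z s]]] /= => [e|e|e|_]; try by rewrite -e in k2.
case/and3P=> Exy Eyz zP Uc; have /negP := bE _ _ Exy; case.
have [xy xz yz ys xs] : [/\ x != y, x != z, y != z, y \notin s & x \notin s].
  by move: Uc; rewrite !inE !negb_or => /and4P[/and3P[-> -> ->] /andP[-> ->]].
rewrite connect_adjC; apply: connect_trans (_ : connect _ y z) _.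
  apply: connect1; rewrite adjD1 Eyz andbT; apply/eqP => /setP/(_ z).
  by rewrite !inE eqxx orbT ![z == _]eq_sym (negPf xz) (negPf yz).
apply/connectP; exists (rcons s x); last by rewrite last_rcons.
apply: (@sub_in_path _ (predC1 y)) zP => [s' t Ps Pt st|].
  rewrite adjD1 st andbT; apply/eqP => /setP/(_ y).
  by rewrite !inE eqxx orbT ![y == _]eq_sym (negPf Ps) (negPf Pt).
rewrite /= eq_sym yz all_rcons /= xy; apply/allP => w ws.
by apply/eqP => e; rewrite -e ws in ys.
Qed.

Lemma tree_on_setT E : tree E = tree_on [set: V] E.
Proof.
apply/and3P/tree_onP => [[/forall_inP sE cE aE]|[eE cE bE]].
  split=> [e /sE/eqP|x y _ _|u v Euv]; first by split=> //; apply: subsetT.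
    by have /forallP/(_ y) := forallP cE x.
  apply: acyclic_bridge => //; apply/eqP => uv.
  by have := sE _ Euv; rewrite uv setUid cards1.
split; last exact: bridge_acyclic.
  by apply/forall_inP => e /eE[->].
by apply/forallP => x; apply/forallP => y; apply: cE; rewrite inE.
Qed.

Lemma tree_on_adj S E u v : tree_on S E -> adj E u v -> u \in S /\ v \in S.
Proof.
by case/tree_onP=> eE _ _ /eE[_]; rewrite subUset !sub1set => /andP[].
Qed.

Lemma tree_on_neq S E u v : tree_on S E -> adj E u v -> u != v.
Proof. by case/tree_onP=> eE _ _ /eE[]; rewrite cards2; case: eqP. Qed.

Lemma tree_on_edge u v : u != v -> tree_on [set u; v] [set [set u; v]].
Proof.
move=> neq_uv; apply/tree_onP; split=> [e|x y|x y].
- by rewrite inE => /eqP->; rewrite cards2 neq_uv.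
- have c : connect (adj [set [set u; v]]) u v by rewrite connect1 // /adj inE.
  by rewrite !inE => /orP[]/eqP-> /orP[]/eqP-> //; rewrite connect_adjC.
rewrite /adj inE => /eqP xy; rewrite /bridge -xy setDv.
have {}neq_uv : x != y.
  by apply/eqP => e; have := cards2 x y; rewrite xy cards2 neq_uv e eqxx.
apply/negP => /connectP[[|z p] /=]; first by move=> _ e; rewrite e eqxx in neq_uv.
by rewrite /adj inE.
Qed.

(* Collapsing one side of the cut vertex c onto c is a retraction of the graph
   onto the other side. *)
Definition collapse S c x := if x \in S then x else c.

Lemma collapseE S1 S2 c x :
  S1 :&: S2 = [set c] -> x \in S2 -> collapse S1 c x = c.
Proof.
move=> S12 S2x; rewrite /collapse; case: ifP => // S1x.
by apply/set1P; rewrite -S12 inE S1x.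
Qed.

(** A detour around an edge of [E1] may run through [E2]; collapsing [S2] onto c brings it back into
    [E1]. *)
Lemma bridge_glue S1 S2 c E1 E2 u v : S1 :&: S2 = [set c] ->
    tree_on S1 E1 -> tree_on S2 E2 -> adj E1 u v -> bridge (E1 :|: E2) u v.
Proof.
move=> S12 T1 T2 Euv; have [S1u S1v] := tree_on_adj T1 Euv.
have /tree_onP[_ _ /(_ _ _ Euv)] := T1; apply: contra.
suff: connect (adj ((E1 :|: E2) :\ [set u; v])) u v ->
      connect (adj (E1 :\ [set u; v])) (collapse S1 c u) (collapse S1 c v).
  by rewrite /collapse S1u S1v.
apply: connect_map => x y; rewrite adjD1 adjU => /andP[nxy /orP[]] Exy.
  have [S1x S1y] := tree_on_adj T1 Exy; rewrite /collapse S1x S1y.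
  by apply: connect1; rewrite adjD1 nxy.
have [S2x S2y] := tree_on_adj T2 Exy.
by rewrite !(collapseE S12) // connect0.
Qed.

Lemma tree_on_glue S1 S2 c E1 E2 : S1 :&: S2 = [set c] ->
  tree_on S1 E1 -> tree_on S2 E2 -> tree_on (S1 :|: S2) (E1 :|: E2).
Proof.
move=> S12 T1 T2.
have conn_c x : x \in S1 :|: S2 -> connect (adj (E1 :|: E2)) x c.
  have /setIP[S1c S2c] : c \in S1 :&: S2 by rewrite S12 set11.
  case/setUP => Sx; [apply: (connect_adjS (subsetUl _ _))|
                     apply: (connect_adjS (subsetUr _ _))].
    by have /tree_onP[_ ->] := T1.
  by have /tree_onP[_ ->] := T2.
apply/tree_onP; split=> [e|x y /conn_c xc /conn_c yc|u v].
- case/setUP; first by case/tree_onP: T1 => H _ _ /H[-> s]; rewrite subsetU ?s.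
  by case/tree_onP: T2 => H _ _ /H[-> s]; rewrite subsetU ?s ?orbT.
- by apply: connect_trans xc _; rewrite connect_adjC.
rewrite adjU => /orP[]; first exact: bridge_glue S12 T1 T2.
by rewrite setUC; apply: bridge_glue T2 T1; rewrite setIC; apply: S12.
Qed.

Definition restrict E S := [set e in E | e \subset S].

Lemma adj_restrict E S u v :
  adj (restrict E S) u v = [&& adj E u v, u \in S & v \in S].
Proof. by rewrite /adj inE subUset !sub1set. Qed.

Lemma restrict_subset E S : restrict E S \subset E.
Proof. by apply/subsetP => e; rewrite inE => /andP[]. Qed.

Lemma bridgeS E E' u v : E \subset E' -> bridge E' u v -> bridge E u v.
Proof.
by move=> sE; apply: contra; apply: connect_adjS; apply: setSD.
Qed.

(** Collapsing [S2] onto c keeps [S1] connected, since every edge lies on one side; a bridge remains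
    one in a subgraph. *)
Lemma tree_on_split S1 S2 c E : S1 :&: S2 = [set c] ->
    tree_on (S1 :|: S2) E ->
    (forall u v, adj E u v ->
       (u \in S1 /\ v \in S1) \/ (u \in S2 /\ v \in S2)) ->
  tree_on S1 (restrict E S1).
Proof.
move=> S12 /tree_onP[eE cE bE] sE; apply/tree_onP; split=> [e|x y S1x S1y|u v].
- by rewrite inE => /andP[/eE[-> _]].
- suff: connect (adj E) x y ->
        connect (adj (restrict E S1)) (collapse S1 c x) (collapse S1 c y).
    by rewrite /collapse S1x S1y; apply; apply: cE; rewrite inE ?S1x ?S1y.
  apply: connect_map => u v Euv; case: (sE _ _ Euv) => -[Su Sv].
    by rewrite /collapse Su Sv connect1 // adj_restrict Euv Su.
  by rewrite !(collapseE S12).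
rewrite adj_restrict => /andP[/bE + _].
exact/bridgeS/restrict_subset.
Qed.

End TreeOn.

(** * Non-crossing trees on a segment *)

Lemma connect_ind (T : finType) (e : rel T) (P : T -> Prop) x :
    P x -> (forall y z, connect e x y -> P y -> e y z -> P z) ->
  forall y, connect e x y -> P y.
Proof.
move=> Px Pe y /connectP[p]; elim/last_ind: p y => [|p z IHp] y; first by move=> _ ->.
rewrite rcons_path last_rcons => /andP[pP ez] ->.
by apply: Pe ez; [apply/connectP; exists p|apply: IHp].
Qed.

(* Inequalities and equalities between naturals are all that [lia] needs; it is
   slow when the context also contains unrelated boolean facts. *)
Ltac nat_lia :=
  repeat match goal with
  | H : ?T |- _ =>
    lazymatch type of T with Prop =>
      lazymatch T with
      | is_true (leq _ _) => fail
      | is_true (andb (leq _ _) (leq _ _)) => fail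
      | ~ is_true (andb (leq _ _) (leq _ _)) => fail
      | is_true (orb _ _) => fail
      | is_true (negb (@eq_op _ _ _)) => fail
      | ~ is_true (@eq_op _ _ _) => fail
      | @eq nat _ _ => fail
      | _ => clear H
      end
    end
  end; lia.

Section Intervals.

Variable n : nat.
Local Notation V := 'I_n.+1.
Implicit Types (E : {set {set V}}) (u v x y r c m : V) (a b : nat).

Definition segment a b : {set V} := [set v : V | a <= v <= b].

Lemma in_segment a b v : (v \in segment a b) = (a <= v <= b).
Proof. by rewrite inE. Qed.

Lemma noncrossingP E :
  reflect (forall p q s t : V, p < q -> q < s -> s < t ->
             adj E p s -> adj E q t -> False)
          (noncrossing E).
Proof.
apply: (iffP forallP) => [H p q s t pq qs st Eps Eqt|H p].
  have /forallP/(_ q)/forallP/(_ s)/forallP/(_ t)/implyP := H p.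
  by rewrite pq qs st Eps Eqt => /(_ isT).
apply/forallP => q; apply/forallP => s; apply/forallP => t.
apply/implyP => /and3P[pq qs st]; apply/negP => /andP[].
exact: H pq qs st.
Qed.

Lemma noncrossingS E E' : E \subset E' -> noncrossing E' -> noncrossing E.
Proof.
move=> sE /noncrossingP H; apply/noncrossingP => p q s t pq qs st Eps Eqt.
by apply: (H p q s t) => //; apply: (subsetP sE).
Qed.

(** The bounds are natural numbers, so that [m.+1] needs no proof of being a vertex. *)
Definition nct a b : {set {set {set V}}} :=
  [set E | tree_on (segment a b) E && noncrossing E].

Lemma nct_tree a b E : E \in nct a b -> tree_on (segment a b) E.
Proof. by rewrite inE => /andP[]. Qed.

Lemma nct_noncrossing a b E : E \in nct a b -> noncrossing E.
Proof. by rewrite inE => /andP[]. Qed.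

Lemma nct_adj a b E u v :
  E \in nct a b -> adj E u v -> [/\ a <= u, a <= v, u <= b, v <= b & u != v :> nat].
Proof.
move=> /nct_tree T Euv; have [] := tree_on_adj T Euv; rewrite !in_segment.
by have := tree_on_neq T Euv; rewrite -val_eqE /= => -> /andP[-> ->] /andP[-> ->].
Qed.

Lemma eq_adj E E' : simple_graph E -> simple_graph E' ->
  (forall u v, u < v -> adj E u v = adj E' u v) -> E = E'.
Proof.
move=> /forall_inP cE /forall_inP cE' H.
have {}H u v : u != v -> adj E u v = adj E' u v.
  by rewrite -val_eqE neq_ltn => /orP[/H//|/H]; rewrite !(adjC _ u).
apply/setP => e; apply/idP/idP => Ee.
  have /cards2P[x [y [xy ee]]] := cE _ Ee.
  by have := H _ _ xy; rewrite /adj -ee Ee => <-.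
have /cards2P[x [y [xy ee]]] := cE' _ Ee.
by have := H _ _ xy; rewrite /adj -ee Ee.
Qed.

Lemma tree_on_simple (S : {set V}) E : tree_on S E -> simple_graph E.
Proof. by case/tree_onP=> H _ _; apply/forall_inP => e /H[->]. Qed.

Lemma nct_simple a b E : E \in nct a b -> simple_graph E.
Proof. by move=> /nct_tree/tree_on_simple. Qed.

Lemma restrict_simple E (S : {set V}) : simple_graph E -> simple_graph (restrict E S).
Proof.
move=> /forall_inP H; apply/forall_inP => e He; apply: H.
exact: (subsetP (restrict_subset E S)).
Qed.

Lemma restrict_restrict E (S S' : {set V}) :
  restrict (restrict E S) S' = restrict E (S :&: S').
Proof. by apply/setP => e; rewrite !inE subsetI andbA. Qed.

Lemma set2_lt_inj u v x y : u < v -> x < y -> [set u; v] = [set x; y] -> u = x /\ v = y.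
Proof.
move=> uv xy /setP H; move: (H u) (H v) (H x) (H y).
rewrite !inE !eqxx ?orbT -!val_eqE /= => *.
by split; apply: val_inj => /=; lia.
Qed.

Definition glue r c E1 E2 E3 : {set {set V}} :=
  [set [set r; c]] :|: E1 :|: E2 :|: E3.

Lemma nct_glue r m c b E1 E2 E3 : r <= m -> m < c -> c <= b ->
    E1 \in nct r m -> E2 \in nct m.+1 c -> E3 \in nct c b ->
  glue r c E1 E2 E3 \in nct r b.
Proof.
move=> rm mc cb N1 N2 N3; rewrite inE; apply/andP; split.
  have rc : r != c by rewrite -val_eqE /=; nat_lia.
  have Srm : [set r; c] :&: segment r m = [set r].
    by apply/setP => v; rewrite !inE -!val_eqE /=; nat_lia.
  have Smc : ([set r; c] :|: segment r m) :&: segment m.+1 c = [set c].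
    by apply/setP => v; rewrite !inE -!val_eqE /=; nat_lia.
  have Scb : ([set r; c] :|: segment r m :|: segment m.+1 c) :&: segment c b = [set c].
    by apply/setP => v; rewrite !inE -!val_eqE /=; nat_lia.
  have -> : segment r b = [set r; c] :|: segment r m :|: segment m.+1 c :|: segment c b.
    by apply/setP => v; rewrite !inE -!val_eqE /=; nat_lia.
  apply: tree_on_glue Scb _ (nct_tree N3).
  apply: tree_on_glue Smc _ (nct_tree N2).
  exact: tree_on_glue Srm (tree_on_edge rc) (nct_tree N1).
apply/noncrossingP => p q s t pq qs st.
have adj1P u v : adj [set [set r; c]] u v -> u < v -> u = r :> nat /\ v = c :> nat.
  rewrite adj_set1 => /eqP H uv; have rc : r < c by nat_lia.
  by have [-> ->] := set2_lt_inj uv rc H.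
have ps := ltn_trans pq qs; have qt := ltn_trans qs st.
rewrite /glue !adjU -!orbA.
move=> /or4P[/adj1P/(_ ps)[? ?]|E1p|E2p|E3p]
  /or4P[/adj1P/(_ qt)[? ?]|E1q|E2q|E3q]; try nat_lia;
repeat match goal with
| H : is_true (adj E1 _ _) |- _ => move: (nct_adj N1 H) => [? ? ? ? ?]; move: H
| H : is_true (adj E2 _ _) |- _ => move: (nct_adj N2 H) => [? ? ? ? ?]; move: H
| H : is_true (adj E3 _ _) |- _ => move: (nct_adj N3 H) => [? ? ? ? ?]; move: H
end; try by move=> *; nat_lia.
- by move=> ? ?; apply: (noncrossingP _ (nct_noncrossing N1) p q s t).
- by move=> ? ?; apply: (noncrossingP _ (nct_noncrossing N2) p q s t).
- by move=> ? ?; apply: (noncrossingP _ (nct_noncrossing N3) p q s t).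
Qed.

Lemma nct_far_neighbour r b E : E \in nct r b -> r < b -> b <= n ->
  exists c, [/\ r < c, c <= b, adj E r c & forall x, adj E r x -> x <= c].
Proof.
move=> N rb bn; have /tree_onP[_ cE _] := nct_tree N.
have /cE : r \in segment r b by rewrite in_segment; nat_lia.
have bb : b < n.+1 by [].
move=> /(_ (Ordinal bb)); rewrite in_segment /= => /(_ _)/connectP[|[|x p] /=]; first by nat_lia.
  by move=> _ /(congr1 val) /=; nat_lia.
case/andP=> rx _ _; case: (@arg_maxnP _ x (adj E r) val rx) => c rc cmax.
by exists c; have [? ? ? ? ?] := nct_adj N rc; split=> //; nat_lia.
Qed.

(** m is the last vertex up to c that r still reaches once rc is deleted; it is not c because rc is
    a bridge. An edge uv straddling m, with v at most c, would be out of reach of r, hence would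
    separate r from m. *)
Lemma nct_decomp r b E : E \in nct r b -> r < b -> b <= n ->
  exists m c, [/\ r <= m, m < c, c <= b, adj E r c &
    forall u v, u < v -> adj E u v ->
      [\/ u = r /\ v = c, r <= u /\ v <= m, m < u /\ v <= c | c <= u /\ v <= b]].
Proof.
move=> N rb bn; have [c [rc cb Erc cmax]] := nct_far_neighbour N rb bn.
have /tree_onP[_ _ /(_ _ _ Erc) bE] := nct_tree N.
pose E' := E :\ [set r; c]; pose P v := connect (adj E') r v && (v <= c).
have Pr : P r by rewrite /P connect0 ltnW.
case: (@arg_maxnP _ r P val Pr) => m /andP[rm mc] mmax.
have {}mc : m < c.
  rewrite ltn_neqAle mc andbT; apply: contraNneq bE => /val_inj mE.
  by move: rm; rewrite mE.
exists m, c; split=> //; first exact: mmax Pr.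
move=> u v uv Euv.
have [/set2_lt_inj-/(_ uv rc)|/eqP neq] := eqVneq [set u; v] [set r; c].
  by constructor 1.
have E'uv : adj E' u v by rewrite adjD1 Euv andbT; apply/eqP.
have [ru rv ub vb _] := nct_adj N Euv.
have [cu|uc] := leqP c u; first by constructor 4.
(* An edge from r past c contradicts the choice of c, and one from strictly between r and c past c
   crosses rc. *)
have vc : v <= c.
  rewrite leqNgt; apply/negP => cv; move: ru; rewrite leq_eqVlt => /orP[/eqP/val_inj e|ru].
    by have := cmax v; rewrite e => /(_ Euv); nat_lia.
  exact: (noncrossingP _ (nct_noncrossing N) r u c v).
have [mu|um] := ltnP m u; first by constructor 3.
have [vm|mv] := leqP v m; first by constructor 2.
have nKv : ~ connect (adj E') r v.
  by move=> Kv; have := mmax v; rewrite /P Kv vc => /(_ isT) /=; nat_lia.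
have nKu : ~ connect (adj E') r u.
  by move=> Ku; apply: nKv; apply: connect_trans Ku (connect1 E'uv).
(* In [E'], a walk from r meets neither u nor v, so it cannot get between them without crossing the
   edge uv. *)
have inside : forall z, connect (adj E') r z -> ~ (u < z < v).
  apply: connect_ind => [|y z Ky out E'yz /andP[uz zv]]; first by nat_lia.
  have /negP yu : y != u :> nat by apply/eqP => /val_inj e; rewrite e in Ky.
  have /negP yv : y != v :> nat by apply/eqP => /val_inj e; rewrite e in Ky.
  have Eyz : adj E y z by move: E'yz; rewrite adjD1 => /andP[].
  have [yu'|uy'] := ltnP y u.
    exact: (noncrossingP _ (nct_noncrossing N) y u z v).
  apply: (noncrossingP _ (nct_noncrossing N) u z v y) => //; last by rewrite adjC.
  by apply/negP; nat_lia.
have /negP um' : u != m :> nat by apply/eqP => /val_inj e; rewrite e in nKu.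
by case: (inside m rm); nat_lia.
Qed.

Lemma adj_sides E (S1 S2 : {set V}) : simple_graph E ->
    (forall u v, u < v -> adj E u v ->
      (u \in S1 /\ v \in S1) \/ (u \in S2 /\ v \in S2)) ->
  forall u v, adj E u v -> (u \in S1 /\ v \in S1) \/ (u \in S2 /\ v \in S2).
Proof.
move=> /forall_inP sE H u v Euv.
have : u != v by have := sE _ Euv; rewrite cards2 eqSS eqb1.
rewrite -val_eqE neq_ltn => /orP[uv|vu]; first exact: H.
by rewrite adjC in Euv; have := H _ _ vu Euv; tauto.
Qed.

(** Three cuts at a vertex: [r, c] from [c, b] at c, then [r, m] from the rest of [r, c] at r, then
    the edge rc from [m+1, c] at c. *)
Lemma nct_split r m c b E : E \in nct r b -> r <= m -> m < c -> c <= b -> adj E r c ->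
    (forall u v, u < v -> adj E u v ->
      [\/ u = r /\ v = c, r <= u /\ v <= m, m < u /\ v <= c | c <= u /\ v <= b]) ->
  [/\ restrict E (segment r m) \in nct r m,
      restrict E (segment m.+1 c) \in nct m.+1 c,
      restrict E (segment c b) \in nct c b &
      E = glue r c (restrict E (segment r m)) (restrict E (segment m.+1 c))
                   (restrict E (segment c b))].
Proof.
move=> N rm mc cb Erc H.
have sE := nct_simple N.
have S12 : segment r c :&: segment c b = [set c].
  by apply/setP => v; rewrite !inE -!val_eqE /=; nat_lia.
have D12 : segment r b = segment r c :|: segment c b.
  by apply/setP => v; rewrite !inE; nat_lia.
have SE12 : forall u v, adj E u v ->
    u \in segment r c /\ v \in segment r c \/ u \in segment c b /\ v \in segment c b.
  apply: adj_sides => // u v uv /(H _ _ uv).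
  by rewrite !in_segment; case=> -[] => [-> ->|? ?|? ?|? ?]; nat_lia.
have Tr : tree_on (segment r c :|: segment c b) E by rewrite -D12; apply: nct_tree.
have T1 := tree_on_split S12 Tr SE12.
have T3 : tree_on (segment c b) (restrict E (segment c b)).
  apply: (@tree_on_split _ _ (segment r c) c); first by rewrite setIC.
    by rewrite setUC.
  by move=> u v /SE12; tauto.
set E' := restrict E (segment r c) in T1.
pose S2 := r |: segment m.+1 c.
have SE34 : forall u v, adj E' u v ->
    u \in segment r m /\ v \in segment r m \/ u \in S2 /\ v \in S2.
  apply: adj_sides; first exact: restrict_simple.
  move=> u v uv; rewrite adj_restrict => /and3P[/(H _ _ uv) + + +].
  rewrite !inE -!val_eqE => Huv /andP[ru uc] /andP[rv vc].
  case: Huv => -[] => [-> ->|? ?|? ?|? ?] /=.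
  - by right; split; nat_lia.
  - by left; split; nat_lia.
  - by right; split; nat_lia.
  - by nat_lia.
have S34 : segment r m :&: S2 = [set r].
  by apply/setP => v; rewrite !inE -!val_eqE /=; nat_lia.
have D34 : segment r c = segment r m :|: S2.
  by apply/setP => v; rewrite !inE -!val_eqE /=; nat_lia.
rewrite D34 in T1; have T4 := tree_on_split S34 T1 SE34.
have {}T1 : tree_on S2 (restrict E' S2).
  apply: (@tree_on_split _ _ (segment r m) r); [by rewrite setIC|by rewrite setUC|].
  by move=> u v /SE34; tauto.
have T2 : tree_on (segment m.+1 c) (restrict (restrict E' S2) (segment m.+1 c)).
  apply: (@tree_on_split _ _ [set r; c] c).
  - by apply/setP => v; rewrite !inE -!val_eqE /=; nat_lia.
  - rewrite [_ :|: _](_ : _ = S2) //.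
    by apply/setP => v; rewrite !inE -!val_eqE /=; nat_lia.
  apply: adj_sides; first by do 2!apply: restrict_simple.
  move=> u v uv; rewrite !adj_restrict -!andbA => /and5P[/(H _ _ uv) Huv + + uS vS].
  rewrite !inE -!val_eqE /= in uS vS * => /andP[ru uc] /andP[rv vc].
  case: Huv => -[] => [-> ->|? ?|? ?|? ?] /=.
  - by right; split; nat_lia.
  - by nat_lia.
  - by left; split; nat_lia.
  - by nat_lia.
rewrite !restrict_restrict ?setIA in T4 T2.
have R4 : segment r c :&: segment r m = segment r m.
  by apply/setP => v; rewrite !inE; nat_lia.
have R2 : segment r c :&: S2 :&: segment m.+1 c = segment m.+1 c.
  by apply/setP => v; rewrite !inE -!val_eqE /=; nat_lia.
rewrite R4 in T4; rewrite R2 in T2.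
have nE S : noncrossing (restrict E S).
  exact: noncrossingS (restrict_subset _ _) (nct_noncrossing N).
have N1 : restrict E (segment r m) \in nct r m by rewrite inE T4 nE.
have N2 : restrict E (segment m.+1 c) \in nct m.+1 c by rewrite inE T2 nE.
have N3 : restrict E (segment c b) \in nct c b by rewrite inE T3 nE.
split=> //; apply: eq_adj => //; first exact: nct_simple (nct_glue rm mc cb N1 N2 N3).
move=> u v uv; rewrite /glue !adjU !adj_restrict; apply/idP/idP => [Euv|].
  rewrite adj_set1 Euv !in_segment.
  case: (H _ _ uv Euv) => -[] => [-> ->|? ?|? ?|? ?]; first by rewrite eqxx.
  - have -> : r <= u <= m by nat_lia.
    have -> : r <= v <= m by nat_lia. by rewrite /= !orbT.
  - have -> : m < u <= c by nat_lia.
    have -> : m < v <= c by nat_lia.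
    by rewrite /= !orbT.
  - have -> : c <= u <= b by nat_lia.
    have -> : c <= v <= b by nat_lia.
    by rewrite /= !orbT.
rewrite -!orbA => /or4P[|/and3P[]|/and3P[]|/and3P[]] //.
by rewrite adj_set1 => /eqP e; rewrite /adj e.
Qed.

Lemma glue_reach r m c b E1 E2 E3 z : r <= m -> m < c -> c <= b ->
    E1 \in nct r m -> E2 \in nct m.+1 c -> E3 \in nct c b ->
  connect (adj (glue r c E1 E2 E3 :\ [set r; c])) r z -> z <= m.
Proof.
move=> rm mc cb N1 N2 N3; move: z; apply: connect_ind => // y z _ ym.
rewrite adjD1 !adjU -!orbA => /andP[nyz /or4P[|/(nct_adj N1)[]|/(nct_adj N2)[]|/(nct_adj N3)[]]] //.
- by rewrite adj_set1 (negPf nyz).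
- by nat_lia.
- by nat_lia.
Qed.

Lemma glue_adj_root r m c b E1 E2 E3 x : r <= m -> m < c -> c <= b ->
    E1 \in nct r m -> E2 \in nct m.+1 c -> E3 \in nct c b ->
  adj (glue r c E1 E2 E3) r x -> x <= c.
Proof.
move=> rm mc cb N1 N2 N3; rewrite !adjU -!orbA.
case/or4P => [|/(nct_adj N1)[]|/(nct_adj N2)[]|/(nct_adj N3)[]]; try nat_lia.
rewrite adj_set1 => /eqP/setP/(_ x); rewrite !inE eqxx orbT -!val_eqE /=; nat_lia.
Qed.

Lemma adj_glue r c E1 E2 E3 : adj (glue r c E1 E2 E3) r c.
Proof. by rewrite !adjU adj_set1 eqxx. Qed.

(** c is the largest neighbour of r, and m the last vertex that r reaches without the edge rc. One
    inequality suffices for each, as the two decompositions can exchange roles. *)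
Lemma glue_bounds r m c m' c' b E1 E2 E3 E1' E2' E3' :
    r <= m -> m < c -> c <= b -> r <= m' -> m' < c' -> c' <= b ->
    E1 \in nct r m -> E2 \in nct m.+1 c -> E3 \in nct c b ->
    E1' \in nct r m' -> E2' \in nct m'.+1 c' -> E3' \in nct c' b ->
  glue r c E1 E2 E3 = glue r c' E1' E2' E3' -> c' <= c /\ (c = c' -> m' <= m).
Proof.
move=> rm mc cb rm' mc' cb' N1 N2 N3 N1' N2' N3' e; split.
  by apply: (glue_adj_root rm mc cb N1 N2 N3); rewrite e adj_glue.
move=> ec; apply: (glue_reach rm mc cb N1 N2 N3); rewrite e ec.
apply: (@connect_adjS _ E1').
  apply/subsetP => x E1x; rewrite !inE E1x orbT !andbT.
  case/tree_onP: (nct_tree N1') => /(_ _ E1x)[_ sx] _ _.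
  apply: contraTneq sx => ->; rewrite subUset !sub1set !in_segment; nat_lia.
have /tree_onP[_ H _] := nct_tree N1'.
by apply: H; rewrite in_segment; nat_lia.
Qed.

(** Two pieces share at most one vertex, so restricting to one of them keeps no edge of another. *)
Lemma glue_restrict r m c b E1 E2 E3 : r <= m -> m < c -> c <= b ->
    E1 \in nct r m -> E2 \in nct m.+1 c -> E3 \in nct c b ->
  [/\ restrict (glue r c E1 E2 E3) (segment r m) = E1,
      restrict (glue r c E1 E2 E3) (segment m.+1 c) = E2 &
      restrict (glue r c E1 E2 E3) (segment c b) = E3].
Proof.
move=> rm mc cb N1 N2 N3; have sE := nct_simple (nct_glue rm mc cb N1 N2 N3).
have adj1P u v : u < v -> adj [set [set r; c]] u v -> u = r /\ v = c.
  by move=> uv; rewrite adj_set1 => /eqP/set2_lt_inj; apply => //; nat_lia.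
split; apply: eq_adj; try exact: restrict_simple; try exact: nct_simple N1;
  try exact: nct_simple N2; try exact: nct_simple N3;
  move=> u v uv; rewrite adj_restrict /glue !adjU -!orbA !in_segment.
- apply/idP/idP => [/and3P[
      /or4P[/(adj1P _ _ uv)[-> ->]|//|/(nct_adj N2)[]|/(nct_adj N3)[]]]|
      E1uv]; try nat_lia.
  by rewrite E1uv orbT /=; have [] := nct_adj N1 E1uv; nat_lia.
- apply/idP/idP => [/and3P[
      /or4P[/(adj1P _ _ uv)[-> ->]|/(nct_adj N1)[]|//|/(nct_adj N3)[]]]|
      E2uv]; try nat_lia.
  by rewrite E2uv !orbT /=; have [] := nct_adj N2 E2uv; nat_lia.
- apply/idP/idP => [/and3P[
      /or4P[/(adj1P _ _ uv)[-> ->]|/(nct_adj N1)[]|/(nct_adj N2)[]|//]]|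
      E3uv]; try nat_lia.
  by rewrite E3uv !orbT /=; have [] := nct_adj N3 E3uv; nat_lia.
Qed.

Lemma glue_inj r m c m' c' b E1 E2 E3 E1' E2' E3' :
    r <= m -> m < c -> c <= b -> r <= m' -> m' < c' -> c' <= b ->
    E1 \in nct r m -> E2 \in nct m.+1 c -> E3 \in nct c b ->
    E1' \in nct r m' -> E2' \in nct m'.+1 c' -> E3' \in nct c' b ->
  glue r c E1 E2 E3 = glue r c' E1' E2' E3' ->
  (m, c, E1, E2, E3) = (m', c', E1', E2', E3').
Proof.
move=> rm mc cb rm' mc' cb' N1 N2 N3 N1' N2' N3' e.
have [cc mm] := glue_bounds rm mc cb rm' mc' cb' N1 N2 N3 N1' N2' N3' e.
have [cc' mm'] := glue_bounds rm' mc' cb' rm mc cb N1' N2' N3' N1 N2 N3 (esym e).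
have ec : c = c' by apply: val_inj => /=; nat_lia.
have em : m = m' by apply: val_inj => /=; have := mm ec; have := mm' (esym ec); nat_lia.
subst c' m'; have [e1 e2 e3] := glue_restrict rm mc cb N1 N2 N3.
have := glue_restrict rm mc cb N1' N2' N3'; rewrite -e e1 e2 e3.
by case=> -> -> ->.
Qed.

End Intervals.

Arguments segment {n} a b.
Arguments nct {n} a b.

(** * Covered gaps *)

Section Weights.

Variable n : nat.
Local Notation V := 'I_n.+1.
Implicit Types (E : {set {set V}}) (u v x y r c m : V) (a b k : nat).

(* In a tree rooted at r, the end u of an edge uv is the parent of v iff u stays
   connected to r once uv is deleted. Thus the gap between p_k and p_{k+1} is
   covered when it lies under an edge whose child is to the left of its parent;
   the labels must then agree on both sides of the gap. *)
Definition covered r E k : bool :=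
  [exists u : V, exists v : V,
    [&& adj E u v, connect (adj (E :\ [set u; v])) r u, v <= k & k < u]].

Lemma coveredP r E k :
  reflect (exists u v, [/\ adj E u v, connect (adj (E :\ [set u; v])) r u,
                           v <= k & k < u])
          (covered r E k).
Proof.
apply: (iffP existsP) => [[u /existsP[v /and4P[? ? ? ?]]]|[u [v [? ? ? ?]]]].
  by exists u, v.
by exists u; apply/existsP; exists v; apply/and4P.
Qed.

(** A walk from r to z has a first step from the right of the gap to its left. Until then it stays
    to the right, hence avoids that edge, whose right end is therefore the parent. *)
Lemma covered_separating r z E k :
  connect (adj E) r z -> z <= k -> k < r -> covered r E k.
Proof.
move=> rz zk kr; apply: contraLR zk => nc.
pose R := restrict E [set x : V | k < x].
suff /(_ z rz) [] : forall y, connect (adj E) r y ->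
  connect (adj R) r y /\ k < y by rewrite -ltnNge.
apply: connect_ind => // y w _ [Ry ky] Eyw; have [wk|kw] := leqP w k.
  case/negP: nc; apply/coveredP; exists y, w; split=> //.
  apply: connect_adjS Ry; apply/subsetP => e; rewrite !inE => /andP[-> s].
  rewrite andbT; apply: contraTneq s => ->.
  by rewrite subUset !sub1set !inE [k < w]ltnNge wk andbF.
split=> //; apply: connect_trans Ry (connect1 _).
by rewrite adj_restrict Eyw !inE ky.
Qed.

Section Glue.

Variables (r m c : V) (b : nat) (E1 E2 E3 : {set {set V}}).
Hypotheses (rm : r <= m) (mc : m < c) (cb : c <= b).
Hypotheses (N1 : E1 \in nct r m) (N2 : E2 \in nct m.+1 c) (N3 : E3 \in nct c b).

Let G := glue r c E1 E2 E3.

Let adjG u v : adj G u v ->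
  [\/ (u = r /\ v = c) \/ (u = c /\ v = r), adj E1 u v, adj E2 u v | adj E3 u v].
Proof.
rewrite !adjU -!orbA adj_set1 => /or4P[/eqP e| | |];
  [constructor 1|by constructor|by constructor|by constructor].
have uv : u != v.
  apply/eqP => uv; have := congr1 (fun A : {set V} => #|A|) e.
  have rc : r != c by rewrite -val_eqE /=; nat_lia.
  by rewrite !cards2 uv eqxx rc.
move: uv; rewrite -val_eqE neq_ltn /= => /orP[] uv; have rc : r < c by nat_lia.
  by left; apply: set2_lt_inj.
by right; rewrite setUC in e; have [-> ->] := set2_lt_inj uv rc e.
Qed.

Let E1G : E1 \subset G. Proof. by apply/subsetP => e Ee; rewrite !inE Ee !orbT. Qed.
Let E2G : E2 \subset G. Proof. by apply/subsetP => e Ee; rewrite !inE Ee !orbT. Qed.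
Let E3G : E3 \subset G. Proof. by apply/subsetP => e Ee; rewrite !inE Ee !orbT. Qed.

Let adj_rc u v : m < u -> m < v -> adj (G :\ [set u; v]) r c.
Proof.
move=> mu mv; rewrite adjD1 adj_glue andbT; apply/eqP => /setP/(_ r).
by rewrite !inE eqxx -!val_eqE /=; nat_lia.
Qed.

(** Everything outside [r, m] hangs from r and can be collapsed onto r. *)
Lemma connect_glue_left u v : adj E1 u v ->
  connect (adj (G :\ [set u; v])) r u = connect (adj (E1 :\ [set u; v])) r u.
Proof.
move=> Euv; have [ru _ um _ _] := nct_adj N1 Euv.
apply/idP/idP; last by apply: connect_adjS; apply: setSD.
pose f := collapse (segment r m) r.
have fr : f r = r by rewrite /f /collapse; case: ifP.
have fu : f u = u by rewrite /f /collapse in_segment ru um.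
suff: connect (adj (G :\ [set u; v])) r u -> connect (adj (E1 :\ [set u; v])) (f r) (f u).
  by rewrite fr fu.
apply: connect_map => x y.
rewrite adjD1 => /andP[nxy /adjG[[][-> ->]|Exy|Exy|Exy]].
- by rewrite /f /collapse !in_segment; case: ifP => //; case: ifP => //; nat_lia.
- by rewrite /f /collapse !in_segment; case: ifP => //; case: ifP => //; nat_lia.
- have [? ? ? ? _] := nct_adj N1 Exy; rewrite /f /collapse !in_segment.
  by do 2!(rewrite ifT; last by nat_lia); rewrite connect1 // adjD1 nxy.
- have [? ? ? ? _] := nct_adj N2 Exy; rewrite /f /collapse !in_segment.
  by do 2!(rewrite ifF; last by nat_lia).
- have [? ? ? ? _] := nct_adj N3 Exy; rewrite /f /collapse !in_segment.
  by do 2!(rewrite ifF; last by nat_lia).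
Qed.

(** From r one gets to c by the edge rc; conversely everything outside [c, b] can be collapsed onto
    c. *)
Lemma connect_glue_right u v : adj E3 u v ->
  connect (adj (G :\ [set u; v])) r u = connect (adj (E3 :\ [set u; v])) c u.
Proof.
move=> Euv; have [cu cv ub vb _] := nct_adj N3 Euv.
apply/idP/idP; last first.
  have Grc : connect (adj (G :\ [set u; v])) r c.
    by apply/connect1/adj_rc; nat_lia.
  by move=> H; apply: connect_trans Grc (connect_adjS _ H); apply: setSD.
pose f := collapse (segment c b) c.
have fr : f r = c by rewrite /f /collapse in_segment ifF //; nat_lia.
have fc : f c = c by rewrite /f /collapse; case: ifP.
have fu : f u = u by rewrite /f /collapse in_segment cu ub.
suff: connect (adj (G :\ [set u; v])) r u -> connect (adj (E3 :\ [set u; v])) (f r) (f u).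
  by rewrite fr fu.
apply: connect_map => x y.
have fE2 (z : V) : z <= c -> f z = c.
  rewrite /f /collapse in_segment; case: ifP => // + zc.
  by move=> cz; apply: val_inj => /=; nat_lia.
rewrite adjD1 => /andP[nxy /adjG[[][-> ->]|Exy|Exy|Exy]]; rewrite ?fr ?fc //.
- by have [? ? ? ? _] := nct_adj N1 Exy; rewrite !fE2 //; nat_lia.
- by have [? ? ? ? _] := nct_adj N2 Exy; rewrite !fE2 //; nat_lia.
- have [? ? ? ? _] := nct_adj N3 Exy; rewrite /f /collapse !in_segment.
  by do 2!(rewrite ifT; last by nat_lia); rewrite connect1 // adjD1 nxy.
Qed.

(** Apart from edges of [E1], only rc passes over these gaps, and its child c is to the right of its
    parent r. *)
Lemma covered_glue_left k : k < m -> covered r G k = covered r E1 k.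
Proof.
move=> km; apply/coveredP/coveredP => [] [u [v [Euv conn vk ku]]]; exists u, v.
  case: (adjG Euv) => [[][eu ev]|E1uv|/(nct_adj N2)[]|/(nct_adj N3)[]]; try nat_lia.
  - by subst u v; nat_lia.
  - subst u v; rewrite setUC in conn.
    by have := glue_reach rm mc cb N1 N2 N3 conn; nat_lia.
  - by split=> //; rewrite -connect_glue_left.
by split=> //; [apply: (subsetP E1G)|rewrite connect_glue_left].
Qed.

Lemma covered_glue_gap : covered r G m = false.
Proof.
apply/coveredP => [] [u [v [Euv conn vk ku]]].
case: (adjG Euv) => [[][eu ev]|/(nct_adj N1)[]|/(nct_adj N2)[]|/(nct_adj N3)[]]; try nat_lia.
- by subst u v; nat_lia.
- subst u v; rewrite setUC in conn.
  by have := glue_reach rm mc cb N1 N2 N3 conn; nat_lia.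
Qed.

(** In [E2], rooted at c, a walk from c to m + 1 must pass the gap from right to left; in the glued
    tree, r reaches c through rc. *)
Lemma covered_glue_mid k : m < k < c -> covered r G k.
Proof.
case/andP=> mk kc.
have mn : m.+1 < n.+1 by apply: leq_ltn_trans mc (ltn_ord c).
have /tree_onP[_ conn2 _] := nct_tree N2.
have /coveredP[u [v [Euv conn vk ku]]] : covered c E2 k.
  apply: (@covered_separating c (Ordinal mn)) => //.
  by apply: conn2; rewrite in_segment /=; nat_lia.
have [? ? ? ? _] := nct_adj N2 Euv.
apply/coveredP; exists u, v; split=> //; first exact: (subsetP E2G).
apply: connect_trans (connect1 (adj_rc _ _)) (connect_adjS _ conn); try nat_lia.
exact: setSD.
Qed.

Lemma covered_glue_right k : c <= k -> covered r G k = covered c E3 k.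
Proof.
move=> ck; apply/coveredP/coveredP => [] [u [v [Euv conn vk ku]]]; exists u, v.
  case: (adjG Euv) => [[][eu ev]|/(nct_adj N1)[]|/(nct_adj N2)[]|E3uv]; try nat_lia.
  - by subst u v; nat_lia.
  - by subst u v; nat_lia.
  - by split=> //; rewrite -connect_glue_right.
by split=> //; [apply: (subsetP E3G)|rewrite connect_glue_right].
Qed.

End Glue.

Definition weight r b E : nat := \prod_(r <= k < b) (if covered r E k then 1 else 2).

Lemma weight_glue r m c b E1 E2 E3 : r <= m -> m < c -> c <= b ->
    E1 \in nct r m -> E2 \in nct m.+1 c -> E3 \in nct c b ->
  weight r b (glue r c E1 E2 E3) = 2 * weight r m E1 * weight c b E3.
Proof.
move=> rm mc cb N1 N2 N3.
(* The gaps are [r, m), m, (m, c) and [c, b): m contributes 2, and (m, c) only factors 1. *)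
rewrite /weight (@big_cat_nat _ _ _ c) //=; last by nat_lia.
rewrite (@big_cat_nat _ _ _ m) //=; last by nat_lia.
rewrite [\prod_(m <= _ < c) _]big_ltn // (covered_glue_gap rm mc cb N1 N2 N3).
rewrite [\prod_(m.+1 <= _ < c) _]big1_seq => [|k]; last first.
  rewrite mem_index_iota => /andP[_ mkc].
  by rewrite (covered_glue_mid _ _ rm mc cb N2).
rewrite muln1 mulnAC [_ * 2]mulnC -!mulnA; congr (2 * _).
congr (_ * _); apply: eq_big_nat => k /andP[? ?].
  by rewrite (covered_glue_left rm mc cb N1 N2 N3).
by rewrite (covered_glue_right rm mc cb N1 N2 N3).
Qed.

(** The decomposition is a bijection; with an arbitrary [Phi] it serves both the plain and the
    weighted count. *)
Lemma sum_nct r b (Phi : {set {set V}} -> nat) : r < b -> b <= n ->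
  \sum_(E in nct r b) Phi E =
  \sum_(m : V) \sum_(c : V | [&& r <= m, m < c & c <= b])
    \sum_(E1 in nct r m) \sum_(E2 in nct m.+1 c) \sum_(E3 in nct c b)
      Phi (glue r c E1 E2 E3).
Proof.
move=> rb bn; rewrite !pair_big_dep /=.
pose P (t : V * V * {set {set V}} * {set {set V}} * {set {set V}}) :=
  let: (m, c, E1, E2, E3) := t in
  [&& r <= m, m < c, c <= b, E1 \in nct r m, E2 \in nct m.+1 c & E3 \in nct c b].
pose h (t : V * V * {set {set V}} * {set {set V}} * {set {set V}}) :=
  let: (m, c, E1, E2, E3) := t in glue r c E1 E2 E3.
have -> : nct r b = h @: [set t | P t].
  apply/setP => E; apply/idP/imsetP => [N|[[[[[m c] E1] E2] E3]]].
    have [m [c [rm mc cb Erc H]]] := nct_decomp N rb bn.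
    have [N1 N2 N3 EE] := nct_split N rm mc cb Erc H.
    exists (m, c, restrict E (segment r m), restrict E (segment m.+1 c),
            restrict E (segment c b)) => //.
    by rewrite inE; apply/and5P; split=> //; apply/andP.
  by rewrite inE => /and5P[rm mc cb N1 /andP[N2 N3]] ->; apply: nct_glue N1 N2 N3.
rewrite big_imset /=; last first.
  move=> [[[[m c] E1] E2] E3] [[[[m' c'] E1'] E2'] E3']; rewrite !inE /=.
  case/and5P=> rm mc cb N1 /andP[N2 N3]; case/and5P=> rm' mc' cb' N1' /andP[N2' N3'].
  exact: glue_inj rm mc cb rm' mc' cb' N1 N2 N3 N1' N2' N3'.
apply: eq_big => [[[[[m c] E1] E2] E3]|[[[[m c] E1] E2] E3]] //.
by rewrite inE /= -!andbA.
Qed.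

Lemma card_nct_rec r b : r < b -> b <= n ->
  #|@nct n r b| =
  \sum_(m : V) \sum_(c : V | [&& r <= m, m < c & c <= b])
    #|@nct n r m| * #|@nct n m.+1 c| * #|@nct n c b|.
Proof.
move=> rb bn; rewrite -sum1_card sum_nct //.
apply: eq_bigr => m _; apply: eq_bigr => c _.
by rewrite !sum_nat_const muln1 mulnA.
Qed.

Lemma sum_weight_rec r b : r < b -> b <= n ->
  \sum_(E in nct r b) weight r b E =
  2 * \sum_(m : V) \sum_(c : V | [&& r <= m, m < c & c <= b])
    (\sum_(E in nct r m) weight r m E) * #|@nct n m.+1 c| *
    \sum_(E in nct c b) weight c b E.
Proof.
move=> rb bn; rewrite sum_nct // big_distrr; apply: eq_bigr => m _.
rewrite big_distrr; apply: eq_bigr => c /and3P[rm mc cb] /=.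
rewrite !big_distrl big_distrr; apply: eq_bigr => E1 N1.
transitivity (\sum_(E2 in @nct n m.+1 c) \sum_(E3 in @nct n c b)
    2 * weight r m E1 * weight c b E3).
  apply: eq_bigr => E2 N2; apply: eq_bigr => E3 N3.
  exact: weight_glue N1 N2 N3.
rewrite sum_nat_const -big_distrr /=.
by rewrite -!mulnA mulnCA [_ * (weight _ _ _ * _)]mulnCA.
Qed.

Lemma nct_diag r : @nct n r r = [set set0].
Proof.
apply/setP => E; rewrite !inE; apply/idP/eqP => [N|->].
  have N' : E \in nct r r by rewrite inE.
  apply: eq_adj; first exact: nct_simple N'.
    by apply/forall_inP => e; rewrite inE.
  move=> u v uv; apply/idP/idP => [/(nct_adj N')[]|]; first by nat_lia.
  by rewrite /adj inE.
apply/andP; split.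
  apply/tree_onP; split=> [e|x y|u v]; rewrite ?inE ?/adj ?inE //.
  move=> xr yr; have -> : x = y by apply: val_inj => /=; nat_lia.
  exact: connect0.
by apply/noncrossingP => p q s t _ _ _; rewrite /adj inE.
Qed.

End Weights.

(** * Parents and labellings *)

Section Distance.

Variable V : finType.
Implicit Types (E : {set {set V}}) (u v r x y : V).

Lemma walk_of_lengthP E k u v :
  reflect (exists p, [/\ size p = k, path (adj E) u p & last u p = v])
          (walk_of_length E k u v).
Proof.
apply: (iffP existsP) => [[p /andP[pP /eqP pl]]|[p [<- pP pl]]].
  by exists p; rewrite size_tuple.
by exists (in_tuple p); rewrite pP pl eqxx.
Qed.

Lemma dist_leq E k u v : walk_of_length E k u v -> dist E u v <= k.
Proof.
move=> W; have [Vk|kV] := leqP #|V| k.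
  by apply: leq_trans Vk; rewrite -(size_iota 0 #|V|) find_size.
rewrite leqNgt; apply/negP => /(before_find 0).
by rewrite nth_iota // add0n W.
Qed.

(** A simple path has fewer than [#|V|] steps, so the search finds a length before its default
    value. *)
Lemma dist_walk E u v : connect (adj E) u v -> walk_of_length E (dist E u v) u v.
Proof.
case/connectP=> p0 /shortenP[p pP Up _] vE.
have kV : size p < #|V| by rewrite -[_.+1]/(size (u :: p)) -(card_uniqP Up) max_card.
have hasW : has (fun k => walk_of_length E k u v) (iota 0 #|V|).
  apply/hasP; exists (size p); first by rewrite mem_iota.
  by apply/walk_of_lengthP; exists p.
have := nth_find 0 hasW; rewrite nth_iota ?add0n //.
by rewrite -[X in _ < X](size_iota 0) -has_find.
Qed.

(** The first case arises if the path never uses uv or stands at v when it first does; if it stands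
    at u, cutting it there gives the second. *)
Lemma path_across E u v x p : path (adj E) x p -> last x p = v ->
  connect (adj (E :\ [set u; v])) x v \/
  exists2 q, path (adj E) x q /\ last x q = u & size q < size p.
Proof.
elim: p x => [x _ /= -> |y p IHp x /= /andP[xy yp] lv]; first by left.
have [e|ne] := eqVneq [set x; y] [set u; v].
  have : x \in [set u; v] by rewrite -e !inE eqxx.
  by rewrite !inE => /orP[/eqP->|/eqP->]; [right; exists [::]|left].
have [yv|[q [yq lq] qp]] := IHp _ yp lv.
  by left; apply: connect_trans yv; apply: connect1; rewrite adjD1 ne.
by right; exists (y :: q); rewrite //= xy.
Qed.

(** A shortest walk from r to v must use uv, or else u and v would be connected around a bridge; the
    part before is a shorter walk to u. *)
Lemma dist_lt E r u v : connect (adj E) r v -> bridge E u v ->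
  connect (adj (E :\ [set u; v])) r u -> dist E r u < dist E r v.
Proof.
move=> rv br ru; have /walk_of_lengthP[p [sp pP lp]] := dist_walk rv.
have [rv'|[q [qP lq] qp]] := path_across u pP lp.
  by case/negP: br; apply: connect_trans rv'; rewrite connect_adjC.
rewrite -sp; apply: leq_ltn_trans qp; apply: dist_leq.
by apply/walk_of_lengthP; exists q.
Qed.

(** This matches parents defined by distance with the side of the root used in [covered]. After the
    deletion r still reaches one end of the edge, and that end is strictly closer to r. *)
Lemma parent_side E S r u v : tree_on S E -> r \in S -> adj E u v ->
  (dist E r u < dist E r v) = connect (adj (E :\ [set u; v])) r u.
Proof.
move=> T rS Euv; have [uS vS] := tree_on_adj T Euv.
have /tree_onP[_ cE bE] := T; have Evu : adj E v u by rewrite adjC.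
apply/idP/idP => [uv|]; last by apply: dist_lt (bE _ _ Euv); apply: cE.
have : forall z, connect (adj E) r z -> let F := adj (E :\ [set u; v]) in
    [\/ connect F r z, connect F r u | connect F r v].
  apply: connect_ind => [|y z _ /= IH Eyz]; first by constructor 1; apply: connect0.
  case: IH => [ry|ru|rv]; [|by constructor 2|by constructor 3].
  have [e|ne] := eqVneq [set y; z] [set u; v].
    have : y \in [set u; v] by rewrite -e !inE eqxx.
    by rewrite !inE => /orP[] /eqP ey; rewrite ey in ry; [constructor 2|constructor 3].
  by constructor 1; apply: connect_trans ry _; apply: connect1; rewrite adjD1 ne.
case/(_ u (cE _ _ rS uS)) => // rv.
have := dist_lt (cE _ _ rS uS) (bE _ _ Evu); rewrite setUC => /(_ rv).
by rewrite ltnNge ltnW.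
Qed.

End Distance.

Lemma discrete_ivt (f : nat -> nat) n k :
    f 0 <= k <= f n -> (forall i, i < n -> f i.+1 <= (f i).+1) ->
  exists2 i, i <= n & f i = k.
Proof.
elim: n => [|n IHn] fk fS; first by exists 0 => //; lia.
have [kn|nk] := leqP k (f n).
  have [|i ile <-] := IHn _ (fun i lin => fS i (ltnW lin)); first by lia.
  by exists i => //; apply: leqW.
by exists n.+1 => //; have := fS n (ltnSn n); lia.
Qed.

Section Labels.

Variable n : nat.
Local Notation V := 'I_n.+1.
Local Notation L := {ffun V -> 'I_n.+2}.
Implicit Types (D : {set 'I_n}) (l : L) (u v : V) (i : nat).

(* A labelling is encoded by the set of k such that p_k and p_{k+1} have
   different labels. *)
Definition jumps D i : nat := #|[set k in D | k < i]|.

(** There are at most n jumps, so the argument of [inord] is always in range. *)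
Definition label D : L := [ffun v : V => inord (jumps D v).+1].

Lemma jumps0 D : jumps D 0 = 0.
Proof. by apply: eq_card0 => k; rewrite !inE andbF. Qed.

Lemma jumpsS D (k : 'I_n) : jumps D k.+1 = (k \in D) + jumps D k.
Proof.
rewrite /jumps (cardsD1 k) !inE ltnSn andbT; congr (_ + #|pred_of_set _|).
by apply/setP => j; rewrite !inE -val_eqE /=; case: (j \in D) => /=; lia.
Qed.

Lemma leq_jumps D i j : i <= j -> jumps D i <= jumps D j.
Proof.
move=> ij; apply/subset_leq_card/subsetP => k.
by rewrite !inE => /andP[-> ki]; apply: leq_trans ij.
Qed.

Lemma ltn_jumps D i j :
  reflect (exists2 k : 'I_n, k \in D & i <= k < j) (jumps D i < jumps D j).
Proof.
apply: (iffP idP) => [lt_ij|[k Dk /andP[ik kj]]].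
  have [k] : exists k, k \in [set k in D | k < j] :\: [set k in D | k < i].
    apply/set0Pn; apply: contraTneq lt_ij => /eqP; rewrite setD_eq0 -leqNgt.
    exact: subset_leq_card.
  rewrite !inE => /and3P[+ Dk kj]; rewrite Dk /= -leqNgt => ik.
  by exists k => //; rewrite ik.
apply: leq_trans (leq_jumps D kj); rewrite jumpsS Dk ltnS; exact: leq_jumps.
Qed.

Lemma labelE D v : label D v = (jumps D v).+1 :> nat.
Proof.
rewrite ffunE inordK // !ltnS -[X in _ <= X]card_ord; exact: max_card.
Qed.

Lemma labelling_label D : labelling (label D).
Proof.
apply/and3P; split.
- apply/forallP => u; apply/forallP => v; apply/implyP => uv.
  by rewrite !labelE ltnS leq_jumps.
- by rewrite labelE jumps0.
apply/existsP; exists (label D ord_max); apply/eqP/setP => k; rewrite inE labelE.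
apply/imsetP/idP => [[v _ ->]|/andP[k0 kD]].
  by rewrite labelE /= ltnS leq_jumps // -ltnS.
(* Labels grow by at most one per step, so no value up to the last label is skipped. *)
have [|i iS|i ile ik] := @discrete_ivt (fun i => (jumps D i).+1) n k.
- by rewrite jumps0 k0.
- by rewrite (jumpsS D (Ordinal iS)) /=; case: (_ \in _).
- exists (inord i) => //; apply: val_inj => /=.
  by rewrite labelE inordK.
Qed.

Lemma label_inj : injective label.
Proof.
move=> D D' eD; apply/setP => k.
have kn : k < n.+1 by apply: ltnW; rewrite ltnS.
have kS : k.+1 < n.+1 by rewrite ltnS.
have := congr1 (fun l : L => val (l (Ordinal kn))) eD.
have := congr1 (fun l : L => val (l (Ordinal kS))) eD.
rewrite /= !labelE /= !jumpsS; lia.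
Qed.

Lemma labelling_surj l : labelling l -> exists D, l = label D.
Proof.
case/and3P=> /forallP mono /eqP l0 /existsP[m /eqP im].
have {}mono u v : u <= v -> l u <= l v by have /forallP/(_ v)/implyP := mono u.
pose D := [set k : 'I_n | l (inord k) < l (inord k.+1)].
exists D; apply/ffunP => v; apply: val_inj; rewrite /= labelE.
suff H i : i <= n -> l (inord i) = (jumps D i).+1 :> nat.
  by rewrite -H ?inord_val // -ltnS.
elim: i => [_|i IHi lin].
  rewrite jumps0 -l0; congr (nat_of_ord (l _)).
  by apply: val_inj; rewrite /= inordK.
have {}IHi := IHi (ltnW lin).
have vi : (inord i : V) = i :> nat by rewrite inordK // ltnS ltnW.
have vS : (inord i.+1 : V) = i.+1 :> nat by rewrite inordK.
rewrite (jumpsS D (Ordinal lin)) inE /= addnC -addSn -IHi.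
have le1 : l (inord i) <= l (inord i.+1) by apply: mono; rewrite vi vS.
case: ltnP => [lt1|]; last by lia.
(* An increase by two or more would skip a value of the label set; the point carrying it would
   contradict monotonicity. *)
apply/eqP; rewrite addn1 eqn_leq lt1 andbT leqNgt; apply/negP => lt2.
have km : (l (inord i)).+1 < n.+2 by apply: leq_trans lt2 (ltnW (ltn_ord _)).
have : l (inord i.+1) \in [set l v | v : V] by apply: imset_f.
rewrite im inE => /andP[_ lm].
have : Ordinal km \in [set l v | v : V] by rewrite im inE /=; lia.
case/imsetP=> w _ /(congr1 val) /= e.
have [wi|iw] := leqP w i.
  by have := mono w (inord i); rewrite vi => /(_ wi); lia.
by have := mono (inord i.+1) w; rewrite vS => /(_ iw); lia.
Qed.

(** An edge with parent u and child v is a descent iff some jump k satisfies v <= k < u. So the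
    admissible jump sets are the subsets of the uncovered gaps. *)
Lemma card_labels (E : {set {set V}}) : E \in nct 0 n ->
  #|[set l | labelling l & [forall u, forall v, ~~ descent (E, l) u v]]|
  = weight ord0 n E.
Proof.
move=> N; pose U := [set k : 'I_n | ~~ covered ord0 E k].
have -> : [set l | labelling l & [forall u, forall v, ~~ descent (E, l) u v]]
          = label @: powerset U.
  have avoidP D : [forall u, forall v, ~~ descent (E, label D) u v] = (D \subset U).
    apply/forallP/subsetP => [H k Dk|DU u].
      rewrite inE; apply/coveredP => -[u [v [Euv conn vk ku]]].
      have /forallP/(_ v)/negP := H u; apply.
      rewrite /descent /parent /= Euv (parent_side (nct_tree N)) ?in_segment // conn.
      rewrite !labelE ltnS; apply/ltn_jumps; exists k; rewrite //; lia.
    apply/forallP => v; apply/negP => /andP[/andP[/= Euv]].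
    rewrite (parent_side (nct_tree N)) ?in_segment // => conn.
    rewrite !labelE ltnS => /ltn_jumps[k /DU]; rewrite inE => /coveredP nc /andP[vk ku].
    by apply: nc; exists u, v.
  apply/setP => l; rewrite inE; apply/andP/imsetP => [[/labelling_surj[D ->]]|[D]].
    by rewrite avoidP => DU; exists D => //; rewrite inE.
  by rewrite inE => DU ->; rewrite labelling_label avoidP.
rewrite card_imset; last exact: label_inj.
rewrite card_powerset /weight big_mkord -prod_nat_const big_mkcond /=.
by apply: eq_bigr => k _; rewrite inE; case: covered.
Qed.

Lemma card_GNC_d_avoiding :
  #|GNC_d_avoiding n| = \sum_(E in @nct n 0 n) weight ord0 n E.
Proof.
have seg : segment 0 n = [set: V].
  by apply/setP => v; rewrite !inE leq_ord.
rewrite -sum1_card (eq_bigl (fun T : {set {set V}} * L => (T.1 \in nct 0 n) &&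
  (labelling T.2 && [forall u, forall v, ~~ descent (T.1, T.2) u v]))); last first.
  by case=> E l; rewrite !inE /= tree_on_setT seg -!andbA.
rewrite -(pair_big_dep (fun E => E \in nct 0 n)
  (fun E l => labelling l && [forall u, forall v, ~~ descent (E, l) u v])
  (fun _ _ => 1)) /=.
apply: eq_bigr => E N; rewrite -card_labels // -sum1_card.
by apply: eq_bigl => l; rewrite inE.
Qed.

End Labels.

(** * Raney numbers and generating functions *)

Import GRing.Theory Num.Theory.
Local Open Scope ring_scope.

(* raney p i j = i / (pj + i) * 'C(pj + i, j) = [t^j] B(t)^i with B = 1 + t B^p,
   written so that i = j = 0 causes no division by zero. *)
Definition raney (p i j : nat) : rat :=
  if j is k.+1 then i%:R / j%:R * 'C((p * j + i).-1, k)%:R else 1.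

(* Pascal's rule for raney, over J = j, m + 1 = p (j + 2) + i, x = 'C(m, j),
   y = 'C(m, j + 1). *)
Lemma raney_identity (K : realFieldType) (J m x y P I : K) :
  0 <= J -> 0 <= m -> m + 1 = (P + 1) * (J + 1 + 1) + I ->
  (m + 1) * x = (J + 1) * (y + x) ->
  (I + 1) / (J + 1 + 1) * (y + x)
  = I / (J + 1 + 1) * y + (I + (P + 1)) / (J + 1) * x.
Proof.
move=> J0 m0 Hm Hx.
have -> : y = (m - J) / (J + 1) * x.
  by rewrite mulrAC; apply: (canRL (mulfK _)); lra.
have -> : I = m + 1 - (P + 1) * (J + 1 + 1) by lra.
by field; apply/andP; split; lra.
Qed.

Lemma raneyS p i j :
  raney p.+1 i.+1 j.+1 = raney p.+1 i j.+1 + raney p.+1 (i + p.+1) j.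
Proof.
case: j => [|j]; rewrite /raney.
  by rewrite !bin0 -natr1; field.
have -> : ((p.+1 * j.+2 + i.+1).-1 = (p.+1 * j.+2 + i).-1.+1)%N by lia.
have -> : ((p.+1 * j.+1 + (i + p.+1)).-1 = (p.+1 * j.+2 + i).-1)%N by lia.
have EM : ((p.+1 * j.+2 + i).-1.+1 = p.+1 * j.+2 + i)%N by lia.
(* All three terms are now binomials of M or M + 1, related by Pascal's rule and absorption. *)
move: (p.+1 * j.+2 + i).-1 EM => M EM.
have := mul_bin_diag M.+1 j; have := binS M j; rewrite succnK.
move: 'C(M, j) 'C(M, j.+1) 'C(M.+1, j.+1) => x y z.
move=> /(congr1 (GRing.natmul (1 : rat))) + /(congr1 (GRing.natmul (1 : rat))).
move: (congr1 (GRing.natmul (1 : rat)) EM).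
rewrite !natrM !natrD !natrM -!natr1.
move=> H0 H2; rewrite H2 => H1.
exact: raney_identity (ler0n _ j) (ler0n _ M) H0 H1.
Qed.

Arguments raney : simpl never.

Lemma raney0 p j : raney p 0 j = (j == 0%N)%:R.
Proof. by case: j => // j; rewrite /raney !mul0r. Qed.

(** Induction on j, then on i: expanding the left factor by [raneyS] splits the sum into the one for
    i and one of total degree j for i + p + 1, where the outer hypothesis applies. *)
Lemma raney_conv p i i' j :
  \sum_(k < j.+1) raney p.+1 i k * raney p.+1 i' (j - k)%N
  = raney p.+1 (i + i') j.
Proof.
elim: j i i' => [|j IHj] i i'.
  by rewrite big_ord1 mulr1.
elim: i => [|i IHi].
  rewrite big_ord_recl raney0 mul1r big1 ?addr0 // => k _.
  by rewrite raney0 mul0r.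
rewrite addSn raneyS -IHi addnAC -IHj.
rewrite [LHS]big_ord_recl [in RHS]big_ord_recl !mul1r -addrA; congr (_ + _).
rewrite -big_split; apply: eq_bigr => k _.
rewrite !lift0 subSS raneyS; exact: mulrDl.
Qed.

Lemma raney_poly_exp p N i j : (j < N)%N ->
  ((\poly_(k < N) raney p.+1 1 k) ^+ i)`_j = raney p.+1 i j.
Proof.
move=> jN; elim: i j jN => [|i IHi] j jN; first by rewrite expr0 coef1 raney0.
rewrite exprS coefM -[i.+1]add1n -raney_conv; apply: eq_bigr => k _.
rewrite coef_poly IHi; last by apply: leq_ltn_trans jN; apply: leq_subr.
by rewrite (leq_ltn_trans _ jN) // -ltnS ltn_ord.
Qed.

(** The Fuss-Catalan form: Catalan numbers for p = 1, coefficients of F for p = 2. *)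
Lemma raney1 p j : raney p.+1 1 j = 'C(p.+1 * j, j)%:R / (p * j + 1)%N%:R.
Proof.
case: j => [|j]; first by rewrite !muln0 bin0 divr1.
rewrite /raney [in LHS]addn1 succnK.
have := mul_bin_left (p.+1 * j.+1) j.
have -> : (p.+1 * j.+1 - j = p * j.+1 + 1)%N by lia.
move=> /(congr1 (GRing.natmul (1 : rat))); rewrite !natrM.
set x := 'C(_, j.+1)%:R => H.
have {H} -> : x = (p * j.+1 + 1)%:R * 'C(p.+1 * j.+1, j)%:R / j.+1%:R.
  by rewrite -H mulrC mulKf ?pnatr_eq0.
rewrite div1r mulrC [RHS]mulrAC [in RHS](mulrC (p * j.+1 + 1)%:R) mulfK //.
by rewrite addn1 pnatr_eq0.
Qed.

Lemma F_coefE k : F_coef k = raney 3 1 k.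
Proof. by rewrite raney1. Qed.

Lemma catalanE k : catalan k = raney 2 1 k.
Proof. by rewrite raney1 mul1n addn1. Qed.

Lemma F_pow_coefE i j : F_pow_coef i j = raney 3 i j.
Proof.
rewrite -(@raney_poly_exp 2 j.+1) //; congr (nth 0 (polyseq (_ ^+ _)) _).
by apply/polyP => k; rewrite !coef_poly F_coefE.
Qed.

(** Power series are represented by truncations, so the series equations hold for coefficients of
    index less than N. *)
Definition catalan_poly N : {poly rat} := \poly_(k < N) catalan k.
Definition F_poly N : {poly rat} := \poly_(k < N) F_coef k.

(* G = H(2 t F), where H = 1 + t H^2 is the Catalan series. *)
Definition G_poly N := catalan_poly N \Po (2%:P * 'X * F_poly N).

Lemma catalan_polyE N : catalan_poly N = \poly_(k < N) raney 2 1 k.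
Proof. by apply/polyP => j; rewrite !coef_poly catalanE. Qed.

Lemma F_polyE N : F_poly N = \poly_(k < N) raney 3 1 k.
Proof. by apply/polyP => j; rewrite !coef_poly F_coefE. Qed.

(** [raneyS] at i = 0 is the equation B = 1 + t B^(p+1). *)
Lemma raney_poly_rec p N k : (k.+1 < N)%N ->
  (\poly_(k < N) raney p.+1 1 k)`_k.+1
  = ((\poly_(k < N) raney p.+1 1 k) ^+ p.+1)`_k.
Proof.
move=> kN; rewrite raney_poly_exp 1?ltnW // coef_poly kN.
by rewrite raneyS raney0 add0r.
Qed.

(** G is the sum of the C_i (2 t F)^i, and the factor t^i removes the terms with i > k. *)
Lemma G_polyE N k : (k < N)%N ->
  (G_poly N)`_k = \sum_(i < k.+1) F_pow_coef i (k - i) * 2 ^+ i * catalan i.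
Proof.
move=> kN; rewrite /G_poly /catalan_poly poly_def raddf_sum coef_sum /=.
rewrite (big_ord_widen_cond N xpredT
  (fun i => F_pow_coef i (k - i) * 2 ^+ i * catalan i)) // [RHS]big_mkcond /=.
apply: eq_bigr => i _; rewrite comp_polyZ rmorphXn /= comp_polyX coefZ.
rewrite !exprMn -rmorphXn -mulrA coefCM [LHS]mulrC coefXnM ltnS ltnNge.
case: leqP => [ik|_] /=; last by rewrite mulr0 mul0r.
rewrite F_polyE raney_poly_exp ?F_pow_coefE; first by rewrite (mulrC (2 ^+ _)).
by apply: leq_ltn_trans kN; apply: leq_subr.
Qed.

Lemma G_poly0 N : (G_poly N.+1)`_0 = 1.
Proof.
by rewrite G_polyE // big_ord1 F_pow_coefE raney0 catalanE !mulr1.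
Qed.

Lemma F_poly_rec N k : (k.+1 < N)%N -> (F_poly N)`_k.+1 = (F_poly N ^+ 3)`_k.
Proof. by rewrite F_polyE; apply: raney_poly_rec. Qed.

(** The error term is explicit because composition with 2 t F needs an equality of polynomials, not
    just of low coefficients. *)
Lemma catalan_poly_eq N : exists Q,
  catalan_poly N.+1 = 1 + 'X * catalan_poly N.+1 ^+ 2 + Q * 'X^(N.+1).
Proof.
pose D := catalan_poly N.+1 - (1 + 'X * catalan_poly N.+1 ^+ 2).
exists (drop_poly N.+1 D); suff DN : take_poly N.+1 D = 0.
  by move: (poly_take_drop N.+1 D); rewrite DN add0r => ->; rewrite subrKC.
apply/polyP => k; rewrite coef_take_poly coef0; case: ltnP => // kN.
rewrite coefB coefD coefXM coef1; case: k kN => [|k] kN /=.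
  by rewrite coef_poly /catalan bin0 divr1 addr0 subrr.
by rewrite add0r catalan_polyE raney_poly_rec // subrr.
Qed.

Lemma G_poly_rec N k : (k.+1 < N)%N ->
  (G_poly N)`_k.+1 = 2 * (G_poly N * F_poly N * G_poly N)`_k.
Proof.
case: N => // N kN; have [Q HQ] := catalan_poly_eq N.
rewrite {1}/G_poly HQ !comp_polyD !comp_polyM !rmorphXn /= !comp_polyX.
rewrite -/(G_poly _) comp_polyC.
set F := F_poly _; set G := G_poly _; set R := Q \Po _.
(* As 2 t F is divisible by t, the error term remains a multiple of t^(N+1), out of reach of degree
   k + 1. *)
have -> : 1%:P + 2%:P * 'X * F * (G * G) + R * (2%:P * 'X * F) ^+ N.+1
  = 1%:P + 2%:P * ('X * (G * F * G)) + R * (2%:P * F) ^+ N.+1 * 'X^(N.+1).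
  by rewrite [2%:P * 'X * F]mulrAC [(_ * 'X) ^+ _]exprMn; ring.
by rewrite !coefD coefC coefCM coefXM coefMXn kN add0r addr0.
Qed.

Lemma sum_ord_segment n lo hi (F : nat -> rat) : (hi <= n.+1)%N ->
  \sum_(i < n.+1 | (lo <= i < hi)%N) F i = \sum_(i < hi - lo) F (i + lo)%N.
Proof.
move=> hin; rewrite -(big_mkord (fun i => lo <= i < hi)%N F).
rewrite -(big_mkord xpredT (fun i => F (i + lo)%N)).
transitivity (\sum_(0 + lo <= i < hi) F i); last by rewrite big_addn.
by rewrite (big_nat_widenl lo 0) // (big_nat_widen 0 hi n.+1) //.
Qed.

(** The lengths m - r, c - m - 1 and b - c add up to b - r - 1: a Cauchy product indexed by the
    decompositions of [r, b]. *)
Lemma coef_mul3 n (P Q R : {poly rat}) (r b : nat) : (r < b)%N -> (b <= n)%N ->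
  (P * Q * R)`_(b - r).-1 =
  \sum_(m < n.+1) \sum_(c < n.+1 | [&& r <= m, m < c & c <= b]%N)
    P`_(m - r) * Q`_(c - m.+1) * R`_(b - c).
Proof.
move=> rb bn; rewrite coefM.
(* The outer Cauchy product determines c and the inner one m, so the sums are exchanged at the
   end. *)
transitivity (\sum_(c < n.+1 | (r.+1 <= c < b.+1)%N)
    \sum_(m < n.+1 | (r <= m < c)%N) P`_(m - r) * Q`_(c - m.+1) * R`_(b - c)).
  rewrite (@sum_ord_segment n _ _ (fun c => \sum_(m < n.+1 | (r <= m < c)%N)
    P`_(m - r) * Q`_(c - m.+1) * R`_(b - c))); last by lia.
  rewrite subSS -(ltn_predK (_ : 0 < b - r)%N) //; last by lia.
  apply: eq_bigr => i _.
  rewrite (@sum_ord_segment n _ _ (fun m => P`_(m - r) * Q`_(_ - m.+1) * R`_(b - _))).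
  rewrite coefM big_distrl /= (_ : i + r.+1 - r = i.+1)%N; last by lia.
    apply: eq_bigr => j _; congr (_`_ _ * _`_ _ * _`_ _).
    - by rewrite addnK.
    - by rewrite addnS subSS subnDr.
    - by have := ltn_ord i; lia.
  by have := ltn_ord i; move: (nat_of_ord i) => k; lia.
rewrite (exchange_big_dep xpredT) //=; apply: eq_bigr => m _; apply: eq_bigl => c.
lia.
Qed.

(** * Counting trees with and without weights *)

Section Counts.

Variable n : nat.
Local Notation V := 'I_n.+1.
Local Notation F := (F_poly n.+1).
Local Notation G := (G_poly n.+1).

Lemma card_nct (r : V) b : (r <= b)%N -> (b <= n)%N ->
  #|@nct n r b|%:R = F`_(b - r).
Proof.
(* Strong induction on the length b - r, as both ends of the segment vary. *)
have [d] := ubnP (b - r); elim: d r b => // d IHd r b.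
rewrite ltnS => bd; rewrite leq_eqVlt => /orP[/eqP <- _|rb bn].
  by rewrite subnn nct_diag cards1 F_polyE coef_poly.
have -> : (b - r = (b - r).-1.+1)%N by lia.
rewrite card_nct_rec // F_poly_rec; last by lia.
rewrite exprS expr2 mulrA (@coef_mul3 n) // natr_sum.
apply: eq_bigr => m _; rewrite natr_sum; apply: eq_bigr => c /and3P[rm mc cb].
have mn : (m.+1 < n.+1)%N by apply: leq_ltn_trans mc (ltn_ord c).
rewrite !natrM (IHd r m) ?(IHd (Ordinal mn) c) ?(IHd c b) //=; lia.
Qed.

Lemma sum_weight (r : V) b : (r <= b)%N -> (b <= n)%N ->
  (\sum_(E in @nct n r b) weight r b E)%:R = G`_(b - r).
Proof.
have [d] := ubnP (b - r); elim: d r b => // d IHd r b.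
rewrite ltnS => bd; rewrite leq_eqVlt => /orP[/eqP <- _|rb bn].
  by rewrite subnn nct_diag big_set1 /weight big_geq // G_poly0.
have -> : (b - r = (b - r).-1.+1)%N by lia.
rewrite sum_weight_rec // G_poly_rec; last by lia.
rewrite natrM (@coef_mul3 n) // natr_sum; congr (_ * _).
apply: eq_bigr => m _; rewrite natr_sum; apply: eq_bigr => c /and3P[rm mc cb].
have mn : (m.+1 < n.+1)%N by apply: leq_ltn_trans mc (ltn_ord c).
rewrite !natrM (IHd r m) ?(card_nct (r := Ordinal mn)) ?(IHd c b) //=; lia.
Qed.

End Counts.

Theorem theorem2p3 (n : nat) :
  (#|GNC_d_avoiding n|)%:R =
    \sum_(i < n.+1) \sum_(j < n.+1 | (i + j == n)%N)
      F_pow_coef i j * 2 ^+ i * catalan i :> rat.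
Proof.
rewrite card_GNC_d_avoiding (sum_weight (r := ord0)) //= subn0 G_polyE //.
(* For each i, only j = n - i contributes. *)
apply: eq_bigr => i _; have ni : (n - i < n.+1)%N by rewrite ltnS leq_subr.
rewrite (big_pred1 (Ordinal ni)) //= => j.
by rewrite /= -val_eqE /=; have := ltn_ord i; lia.
Qed.
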